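(* Let $P$ be a finite poset and let $f$ be a conservative choice function on $P$. Then $f$ is the union of some elementary choice functions; that is, there is a family $(A_\lambda)_{\lambda\in\Lambda}$ of finite sequences of elements of $P$ such that $f(X)=\bigcup_{\lambda\in\Lambda} f_{A_\lambda}(X)$ for every ideal $X$ of $P$.
   Context: An (order) ideal of a poset $P$ is a subset $X\subseteq P$ such that $x\in X$, $y\le x$ imply $y\in X$; $\mathcal I(P)$ is the set of all ideals (including $\emptyset$ and $P$). For $S\subseteq P$, $I(S)=\{y\in P : y\le s\text{ for some }s\in S\}$ is the ideal generated by $S$. A choice function (CF) on $P$ is a map $f:\mathcal I(P)\to\mathcal I(P)$ with $f(X)\subseteq X$ for every ideal $X$. It has the heredity property if for all ideals $A\subseteq B$ one has $f(B)\cap A\subseteq f(A)$. It has the outcast property if for all ideals $A,B$ with $f(B)\subseteq A\subseteq B$ one has $f(A)=f(B)$. A CF is conservative if it has both the heredity and the outcast properties. Elementary CF: let $A=(a_1,\dots,a_k)$, $k\ge 0$, be a finite sequence of elements of $P$. For an ideal $X$ let $i$ be the least index with $a_i\in X$; if no $a_i$ belongs to $X$, put $i=k$ (so $i=0$ if $k=0$). The elementary CF associated with $A$ is $f_A(X)=X\cap I(\{a_1,\dots,a_i\})$; in particular $f_\emptyset(X)=\emptyset$ for the empty sequence. Unions of CFs are taken pointwise. *)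

(* Defs.v *)
From mathcomp Require Import all_boot all_order.

Set Implicit Arguments.
Unset Strict Implicit.
Unset Printing Implicit Defensive.

Local Open Scope order_scope.

Definition ideals (disp : Order.disp_t) (P : finPOrderType disp) : {set {set P}} :=
  [set X : {set P} | [forall x in X, forall y : P, (y <= x) ==> (y \in X)]].

Definition gen_ideal (disp : Order.disp_t) (P : finPOrderType disp)
    (S : {set P}) : {set P} :=
  [set y : P | [exists s in S, y <= s]].

(* A map between ideals is represented by a function on all subsets of P; every
   property below constrains and uses only its values at ideals. *)
Definition choice_function (disp : Order.disp_t) (P : finPOrderType disp)
    (f : {set P} -> {set P}) : Prop :=
  forall X : {set P}, X \in ideals P -> f X \in ideals P /\ f X \subset X.

Definition heredity (disp : Order.disp_t) (P : finPOrderType disp)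
    (f : {set P} -> {set P}) : Prop :=
  forall A B : {set P}, A \in ideals P -> B \in ideals P ->
    A \subset B -> f B :&: A \subset f A.

Definition outcast (disp : Order.disp_t) (P : finPOrderType disp)
    (f : {set P} -> {set P}) : Prop :=
  forall A B : {set P}, A \in ideals P -> B \in ideals P ->
    f B \subset A -> A \subset B -> f A = f B.

Definition conservative (disp : Order.disp_t) (P : finPOrderType disp)
    (f : {set P} -> {set P}) : Prop :=
  heredity f /\ outcast f.

(* The 1-based index of the first term of A lying in X, and size A if there is
   none: [find] is 0-based and returns size A when the search fails. *)
Definition first_index (disp : Order.disp_t) (P : finPOrderType disp)
    (A : seq P) (X : {set P}) : nat :=
  minn (find (fun a => a \in X) A).+1 (size A).

Definition elementary (disp : Order.disp_t) (P : finPOrderType disp)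
    (A : seq P) (X : {set P}) : {set P} :=
  X :&: gen_ideal [set a in take (first_index A X) A].

Lemma elementary_choice_function (disp : Order.disp_t)
    (P : finPOrderType disp) (A : seq P) : choice_function (elementary A).
Proof.
move=> X; rewrite inE => /forall_inP idX; split; last exact: subsetIl.
rewrite inE; apply/forall_inP => x /setIP[Xx]; rewrite inE.
case/exists_inP=> s As le_xs; apply/forallP=> y; apply/implyP=> le_yx.
rewrite !inE (implyP (forallP (idX x Xx) y) le_yx) /=.
by apply/exists_inP; exists s => //; apply: Order.POrderTheory.le_trans le_xs.
Qed.

(* The pointwise union of a family of maps, stated by membership so that the
   index type may be arbitrary (empty or infinite included). *)
Definition is_union (disp : Order.disp_t) (P : finPOrderType disp)
    (Lambda : Type) (g : Lambda -> {set P} -> {set P})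
    (f : {set P} -> {set P}) : Prop :=
  forall X : {set P}, X \in ideals P ->
    forall x : P, x \in f X <-> exists l : Lambda, x \in g l X.

(* Main.v *)
Require Import Defs.
From mathcomp Require Import all_boot all_order.

(** Call a sequence [a_1, ..., a_k] greedy when each [a_i] belongs to
    [f D_(i-1)], where [D_(i-1)] is the largest ideal avoiding
    [a_1, ..., a_(i-1)].  The greedy sequences are the required family.

    Their elementary choice functions lie below [f]: if an ideal [Y] avoids
    [a_1, ..., a_(i-1)] then [Y] is contained in [D_(i-1)], so by heredity
    every element of [Y] below [a_i], being in [f D_(i-1)], is in [f Y]
    ([elementary_greedy_sub]).

    Conversely, let [x] be in [f X].  As long as [f D] is not contained in [X],
    extend the sequence by an element of [f D] outside [X]; the ideal [D]
    shrinks but still contains [X].  When this stops, [f D] is contained in [X],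
    the outcast property gives [f D = f X], and [x] itself may be the next term:
    it is the first one in [X], so the elementary choice function picks it from
    [X] ([greedy_cover]). *)

Set Implicit Arguments.
Unset Strict Implicit.
Unset Printing Implicit Defensive.

Import Order.TTheory.
Local Open Scope order_scope.

Section GreedySequences.

Variables (disp : Order.disp_t) (P : finPOrderType disp).
Implicit Types (D X Y : {set P}) (A : seq P) (a x y : P).

Lemma idealsP X :
  reflect (forall x y, x \in X -> y <= x -> y \in X) (X \in ideals P).
Proof.
rewrite inE; apply: (iffP forall_inP) => [idX x y Xx le_yx | idX x Xx].
  exact: (implyP (forallP (idX x Xx) y) le_yx).
by apply/forallP => y; apply/implyP; exact: idX Xx.
Qed.

Lemma elementary_nil X : elementary [::] X = set0.
Proof.
apply/setP => x; rewrite !inE; apply/negP => /andP[_ /exists_inP[s]].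
by rewrite inE.
Qed.

(** Turns the index arithmetic of elementary choice functions into a recursion
    on the sequence: later terms count only while no earlier one lies in [X]. *)
Lemma in_elementary_cons a A X x :
  (x \in elementary (a :: A) X) =
  (x \in X) && ((x <= a) || (a \notin X) && (x \in elementary A X)).
Proof.
rewrite /elementary /first_index !inE /= minnSS.
case Xx: (x \in X) => //=.
apply/exists_inP/orP => [[s] | [le_xa | /andP[aNX /exists_inP[s As le_xs]]]].
- rewrite !inE; case: (a \in X) => /=.
    by rewrite min0n take0 orbF => /eqP-> ->; left.
  case/predU1P=> [-> -> | As le_xs]; [by left | right].
  by apply/exists_inP; exists s; rewrite ?inE.
- by exists a; rewrite // !inE eqxx.
exists s => //; move: As.
by rewrite (negPf aNX) !inE => ->; rewrite orbT.
Qed.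

Definition ideal_avoiding D a : {set P} := [set y in D | ~~ (a <= y)].

Lemma ideal_avoiding_ideal D a :
  D \in ideals P -> ideal_avoiding D a \in ideals P.
Proof.
move=> /idealsP idD; apply/idealsP => x y.
rewrite !inE => /andP[Dx aNx] le_yx; rewrite (idD x) //=.
by apply: contra aNx => /le_trans; apply.
Qed.

Lemma sub_ideal_avoiding D a X : X \in ideals P ->
  X \subset D -> a \notin X -> X \subset ideal_avoiding D a.
Proof.
move=> /idealsP idX /subsetP sXD aNX; apply/subsetP => y Xy.
by rewrite inE sXD //=; apply: contra aNX; exact: idX Xy.
Qed.

Variable f : {set P} -> {set P}.

Fixpoint greedy D A : bool :=
  if A is a :: A' then (a \in f D) && greedy (ideal_avoiding D a) A' else true.

Hypothesis f_choice : choice_function f.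

(** Heredity carries each [f D] down to [Y], for the successive ideals [D]
    around [Y] met while reading the sequence. *)
Lemma elementary_greedy_sub D A Y : heredity f ->
    D \in ideals P -> Y \in ideals P -> Y \subset D -> greedy D A ->
  elementary A Y \subset f Y.
Proof.
move=> hered idD idY; elim: A D idD => [|a A IH] D idD sYD /=.
  by rewrite elementary_nil sub0set.
case/andP=> fDa grA; apply/subsetP => x.
rewrite in_elementary_cons => /andP[Yx /orP[le_xa | /andP[aNY xA]]].
  apply: (subsetP (hered Y D idY idD sYD)); rewrite inE Yx andbT.
  have [/idealsP idfD _] := f_choice idD; exact: idfD fDa le_xa.
apply: (subsetP (IH _ (ideal_avoiding_ideal a idD) _ grA)) => //.
exact: sub_ideal_avoiding.
Qed.

(** Discarding elements of [f D] outside [X] shrinks [D] around [X] until the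
    outcast property identifies [f D] with [f X]. *)
Lemma greedy_cover D X x : outcast f ->
    D \in ideals P -> X \in ideals P -> X \subset D -> x \in f X ->
  exists2 A, greedy D A & x \in elementary A X.
Proof.
move=> outc idD idX sXD fXx.
have [n] := ubnP #|D|; elim: n => // n IH in D idD sXD * => leDn.
have [sfDX | /subsetPn[a fDa aNX]] := boolP (f D \subset X).
  exists [:: x]; first by rewrite /= -(outc X D idX idD sfDX sXD) fXx.
  by rewrite in_elementary_cons lexx andbT (subsetP (f_choice idX).2).
have ltD : (#|ideal_avoiding D a| < #|D|)%N.
  apply: proper_card; apply/properP; split.
    by apply/subsetP => y; rewrite inE => /andP[].
  by exists a; rewrite ?inE ?lexx ?andbF // (subsetP (f_choice idD).2).
have [||| A grA xA] := IH (ideal_avoiding D a).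
- exact: ideal_avoiding_ideal.
- exact: sub_ideal_avoiding.
- exact: leq_trans ltD leDn.
exists (a :: A); first by rewrite /= fDa.
by rewrite in_elementary_cons aNX xA orbT andbT (subsetP (f_choice idX).2).
Qed.

End GreedySequences.

Theorem mainTheorem1 (disp : Order.disp_t) (P : finPOrderType disp)
    (f : {set P} -> {set P}) (f_choice : choice_function f)
    (f_conservative : conservative f) :
  exists (Lambda : Type) (A : Lambda -> seq P),
    is_union (fun l : Lambda => elementary (A l)) f.
Proof.
have [hered outc] := f_conservative.
have idT : [set: P] \in ideals P by apply/idealsP => x y; rewrite !inE.
exists {A : seq P | greedy f setT A}, (@sval _ _) => X idX x.
split=> [fXx | [[A grA] /= xA]].
  have [A grA xA] := greedy_cover f_choice outc idT idX (subsetT X) fXx.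
  by exists (exist _ A grA).
exact: (subsetP (elementary_greedy_sub f_choice hered idT idX (subsetT X) grA)).
Qed.
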